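(* Let $\nu\in\mathbb{S}^2\subset\mathbb{R}^3$ and let $A_\nu\in\mathbb{M}^9_{\rm sym}$ be the associated matrix. A matrix $M\in\mathbb{M}^9_{\rm sym}$ satisfies the three conditions (i) $M$ is nonnegative (positive semidefinite), (ii) $\operatorname{Ker}A_\nu\subset\operatorname{Ker}M$, (iii) $\mathbb{R}^9=\operatorname{Ker}(A_\nu-M)+\operatorname{Ker}(A_\nu+M)$, if and only if there exist a symmetric positive definite matrix $S_1\in\mathbb{M}^3$ and a skew symmetric matrix $S_2\in\mathbb{M}^3$ such that both $S_1+S_2$ and $S_1-S_2$ are invertible and the following property holds: for any $(v,\sigma)\in\mathbb{R}^3\times\mathbb{M}^3_{\rm sym}$, defining $$U:=\widetilde{A}_0^{\frac12}\begin{pmatrix}v\\\sigma_{\rm pr}\end{pmatrix}\in\mathbb{R}^9,$$ one has (for each of the two choices of sign) $$(A_\nu\pm M)U=0\quad\Longleftrightarrow\quad(S_1\pm S_2)v\mp\sigma\nu=0.$$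
   Context: $\mathbb{M}^k$ (resp. $\mathbb{M}^k_{\rm sym}$) denotes the real (resp. real symmetric) $k\times k$ matrices. Fix real $\lambda,\mu$ with $\mu>0$ and $2\mu+3\lambda>0$, and set $\alpha=\frac23\sqrt{2\mu}+\frac13\sqrt{2\mu+3\lambda}$, $\beta=-\frac13\sqrt{2\mu}+\frac13\sqrt{2\mu+3\lambda}$. For $\nu=(\nu_1,\nu_2,\nu_3)\in\mathbb{S}^2$ let $$A'_\nu=-\begin{pmatrix}\nu_1\alpha&\nu_1\beta&\nu_1\beta\\\nu_2\beta&\nu_2\alpha&\nu_2\beta\\\nu_3\beta&\nu_3\beta&\nu_3\alpha\end{pmatrix},\quad A''_\nu=-\sqrt\mu\begin{pmatrix}\nu_2&\nu_3&0\\\nu_1&0&\nu_3\\0&\nu_1&\nu_2\end{pmatrix},\quad A_\nu=\begin{pmatrix}0&A'_\nu&A''_\nu\\(A'_\nu)^T&0&0\\(A''_\nu)^T&0&0\end{pmatrix}\in\mathbb{M}^9_{\rm sym}.$$ Let $$\widetilde{C}=\begin{pmatrix}\lambda+2\mu&\lambda&\lambda\\\lambda&\lambda+2\mu&\lambda\\\lambda&\lambda&\lambda+2\mu\end{pmatrix}$$ (symmetric positive definite; $\widetilde{C}^{1/2}$ has diagonal entries $\alpha$ and off-diagonal entries $\beta$) and $$\widetilde{A}_0^{\frac12}=\begin{pmatrix}\mathrm{I}_3&0&0\\0&\widetilde{C}^{-\frac12}&0\\0&0&\mu^{-\frac12}\mathrm{I}_3\end{pmatrix}\in\mathbb{M}^9_{\rm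 sym}.$$ For $\sigma\in\mathbb{M}^3$, $\sigma_{\rm pr}=(\sigma_{11},\sigma_{22},\sigma_{33},\sigma_{12},\sigma_{13},\sigma_{23})^T\in\mathbb{R}^6$. *)

(* Defs.v *)
From mathcomp Require Import all_boot all_order all_algebra.
From mathcomp Require Import reals ring lra.

Set Implicit Arguments.
Unset Strict Implicit.
Unset Printing Implicit Defensive.

Import Order.TTheory GRing.Theory Num.Theory.
Local Open Scope ring_scope.

Section LinearAlgebra.
Variable R : realType.

Definition mx_of_rows (m n : nat) (s : seq (seq R)) : 'M[R]_(m, n) :=
  \matrix_(i < m, j < n) nth 0 (nth [::] s i) j.

(* The kernel for the action on column vectors, u |-> A *m u; the library's
   [kermx A] is the kernel of the action on row vectors, u |-> u *m A. *)
Definition Ker (m n : nat) (A : 'M[R]_(m, n)) : {vspace 'cV[R]_n} :=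
  lker (linfun (mulmx A)).

Lemma mem_Ker m n (A : 'M[R]_(m, n)) (u : 'cV[R]_n) :
  (u \in Ker A) = (A *m u == 0).
Proof. by rewrite memv_ker lfunE. Qed.

(* Symmetry is not part of the next two predicates. *)
Definition nonnegmx (n : nat) (A : 'M[R]_n) : Prop :=
  forall x : 'cV[R]_n, 0 <= (x^T *m A *m x) 0 0.

Definition posdefmx (n : nat) (A : 'M[R]_n) : Prop :=
  forall x : 'cV[R]_n, x != 0 -> 0 < (x^T *m A *m x) 0 0.

End LinearAlgebra.

Section Elasticity.
Variable R : realType.
Variables lambda mu : R.

Definition alpha : R :=
  2 / 3 * Num.sqrt (2 * mu) + 1 / 3 * Num.sqrt (2 * mu + 3 * lambda).

Definition beta : R :=
  - (1 / 3) * Num.sqrt (2 * mu) + 1 / 3 * Num.sqrt (2 * mu + 3 * lambda).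

Definition Ctilde : 'M[R]_3 := mx_of_rows 3 3
  [:: [:: lambda + 2 * mu; lambda; lambda];
      [:: lambda; lambda + 2 * mu; lambda];
      [:: lambda; lambda; lambda + 2 * mu]].

(* The symmetric positive definite square root of [Ctilde]; see
   [Ctilde_sqrtP] and [Ctilde_sqrt_unique]. *)
Definition Ctilde_sqrt : 'M[R]_3 := mx_of_rows 3 3
  [:: [:: alpha; beta; beta];
      [:: beta; alpha; beta];
      [:: beta; beta; alpha]].

Definition A0tilde_sqrt : 'M[R]_(3 + (3 + 3)) :=
  block_mx 1%:M 0
           0    (block_mx (invmx Ctilde_sqrt) 0
                          0                   (Num.sqrt mu)^-1%:M).

Section Direction.
Variable nu : 'cV[R]_3.
Let nu1 := nu 0 0.
Let nu2 := nu 1 0.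
Let nu3 := nu 2 0.

Definition A'_ : 'M[R]_3 := - mx_of_rows 3 3
  [:: [:: nu1 * alpha; nu1 * beta; nu1 * beta];
      [:: nu2 * beta; nu2 * alpha; nu2 * beta];
      [:: nu3 * beta; nu3 * beta; nu3 * alpha]].

Definition A''_ : 'M[R]_3 := - Num.sqrt mu *: mx_of_rows 3 3
  [:: [:: nu2; nu3; 0];
      [:: nu1; 0; nu3];
      [:: 0; nu1; nu2]].

Definition A_ : 'M[R]_(3 + (3 + 3)) :=
  block_mx 0                      (row_mx A'_ A''_)
           (col_mx A'_^T A''_^T)  0.

End Direction.
End Elasticity.

Definition sigma_pr (R : realType) (sigma : 'M[R]_3) : 'cV[R]_(3 + 3) :=
  mx_of_rows (3 + 3) 1
    [:: [:: sigma 0 0]; [:: sigma 1 1]; [:: sigma 2 2];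
        [:: sigma 0 1]; [:: sigma 0 2]; [:: sigma 1 2]].

Section SquareRoot.
Variables (R : realType) (lambda mu : R).
Hypotheses (hmu : 0 < mu) (hlambda : 0 < 2 * mu + 3 * lambda).

Lemma Ctilde_sqrtP :
  [/\ (Ctilde_sqrt lambda mu)^T = Ctilde_sqrt lambda mu,
      posdefmx (Ctilde_sqrt lambda mu) &
      Ctilde_sqrt lambda mu *m Ctilde_sqrt lambda mu = Ctilde lambda mu].
Proof.
have p2 : 0 < 2 * mu by rewrite mulr_gt0.
have a2 := sqr_sqrtr (ltW p2); have b2 := sqr_sqrtr (ltW hlambda).
have a0 : 0 < Num.sqrt (2 * mu) by rewrite sqrtr_gt0.
have b0 : 0 < Num.sqrt (2 * mu + 3 * lambda) by rewrite sqrtr_gt0.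
split.
- by apply/matrixP=> -[[|[|[|//]]] ?] [[|[|[|//]]] ?]; rewrite !mxE.
- move=> x xn0.
  rewrite !mxE !big_ord_recr big_ord0 /= !mxE !big_ord_recr !big_ord0 /= !mxE /=.
  rewrite /alpha /beta.
  set a := Num.sqrt _ in a0 *; set b := Num.sqrt _ in b0 *.
  set x0 := x (widen_ord _ (widen_ord _ _)) 0.
  set x1 := x (widen_ord _ ord_max) 0.
  set x2 := x ord_max 0.
  have [i xi] : exists i, x i 0 != 0.
    apply/existsP; apply: contraR xn0; rewrite negb_exists => /forallP h.
    apply/eqP/matrixP=> i j; rewrite ord1 mxE; apply/eqP.
    by have := h i; rewrite negbK.
  have pos : 0 < x0 ^+ 2 + x1 ^+ 2 + x2 ^+ 2.
    rewrite lt_neqAle !addr_ge0 ?sqr_ge0 // andbT eq_sym.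
    rewrite !paddr_eq0 ?addr_ge0 ?sqr_ge0 // !sqrf_eq0.
    apply: contraNN xi => /andP[/andP[/eqP e0 /eqP e1] /eqP e2].
    case: i => -[|[|[|//]]] lti; apply/eqP;
      [rewrite -[RHS]e0|rewrite -[RHS]e1|rewrite -[RHS]e2];
      by congr (x _ _); apply: val_inj.
  set P := a * ((x0 - x1) ^+ 2 + (x1 - x2) ^+ 2 + (x0 - x2) ^+ 2).
  set Q := b * (x0 + x1 + x2) ^+ 2.
  rewrite [ltRHS](_ : _ = (P + Q) / 3); last by rewrite /P /Q; field.
  have P0 : 0 <= P by rewrite mulr_ge0 ?(ltW a0) // !addr_ge0 ?sqr_ge0.
  have Q0 : 0 <= Q by rewrite mulr_ge0 ?(ltW b0) ?sqr_ge0.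
  rewrite divr_gt0 // lt_neqAle addr_ge0 // andbT eq_sym paddr_eq0 //.
  rewrite (mulf_eq0 a) (mulf_eq0 b) (gt_eqF a0) (gt_eqF b0) /= sqrf_eq0; apply/negP.
  case/andP=> /eqP S /eqP T.
  have : 3 * (x0 ^+ 2 + x1 ^+ 2 + x2 ^+ 2) =
    ((x0 - x1) ^+ 2 + (x1 - x2) ^+ 2 + (x0 - x2) ^+ 2) + (x0 + x1 + x2) ^+ 2.
    by ring.
  by rewrite S T; lra.
- have l3 : lambda = (Num.sqrt (2 * mu + 3 * lambda) ^+ 2
                      - Num.sqrt (2 * mu) ^+ 2) / 3 by rewrite a2 b2; field.
  have m2 : mu = Num.sqrt (2 * mu) ^+ 2 / 2 by rewrite a2; field.
  clear p2 a2 b2 a0 b0; rewrite /Ctilde_sqrt /Ctilde /alpha /beta.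
  set a := Num.sqrt (2 * mu) in l3 m2 *.
  set b := Num.sqrt (2 * mu + 3 * lambda) in l3 *.
  move: a b l3 m2 => a b -> ->.
  by apply/matrixP=> -[[|[|[|//]]] ?] [[|[|[|//]]] ?];
    rewrite !mxE !big_ord_recr big_ord0 /= !mxE /=; field.
Qed.

Lemma Ctilde_sqrt_unique (B : 'M[R]_3) :
  B^T = B -> nonnegmx B -> B *m B = Ctilde lambda mu ->
  B = Ctilde_sqrt lambda mu.
Proof.
have [] := Ctilde_sqrtP; set A := Ctilde_sqrt _ _ => At Apos AA Bt Bpos BB.
apply/eqP; rewrite -subr_eq0; apply/eqP; set D : 'M[R]_3 := B - A.
have Dt : D^T = D by rewrite /D linearB /= At Bt.
have F : A *m D + D *m B = 0.
  by rewrite /D mulmxBr mulmxBl BB AA addrC -addrA addKr subrr.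
have G : \tr (D *m A *m D) = - \tr (D *m B *m D).
  rewrite -mulmxA (_ : A *m D = - (D *m B)); last by apply/eqP; rewrite -addr_eq0 F.
  by rewrite mulmxN linearN /= mxtrace_mulC.
have q (X : 'M[R]_3) i : (D *m X *m D) i i = ((col i D)^T *m X *m col i D) 0 0.
  rewrite -{1}Dt !mxE; apply: eq_bigr => j _; rewrite !mxE; congr (_ * _).
  by apply: eq_bigr => k _; rewrite !mxE.
have B0 : 0 <= \tr (D *m B *m D) by apply: sumr_ge0 => i _; rewrite q.
have Age i : 0 <= (D *m A *m D) i i.
  rewrite q; have [->|/Apos/ltW//] := eqVneq (col i D) 0.
  by rewrite mulmx0 mxE.
have A0 : \tr (D *m A *m D) = 0.
  apply/eqP; rewrite eq_le sumr_ge0 ?andbT; last by move=> i _; apply: Age.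
  by rewrite G oppr_le0.
apply/matrixP=> i j; rewrite [RHS]mxE.
have [/matrixP/(_ i 0)|/Apos] := eqVneq (col j D) 0; first by rewrite !mxE.
have := psumr_eq0P (fun i _ => Age i) A0 isT : (D *m A *m D) j j = 0.
by rewrite q => ->; rewrite ltxx.
Qed.

End SquareRoot.

(* Main.v *)
(** In the variables [(v, D sigma_pr)] the matrix [A_nu] has off-diagonal blocks
    [B] and [B^T], where [B D sigma_pr = - sigma nu] and [B] is onto, so that
    [x^T A x = 2 v . B t] for [x = (v, t)] and [A x = 0] forces [v = 0].

    If (i)-(iii) hold, an [x] in [Ker (A + M)] with [x^T A x = 0] satisfies
    [x^T M x = 0], hence [M x = 0] and [A x = 0]; the same holds for
    [Ker (A - M)].  Splitting the vectors [(0, C w)], with [B C = 1], along (iii)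
    then shows that both kernels project onto all the [v]'s: they are
    [{B t = - G v}] and [{B t = H v}].  The two kernels are orthogonal for the
    form [A], which means [H = G^T], and [G] is positive definite because
    [- A] is positive on [Ker (A + M)] modulo [Ker A].  The matrices [S1] and
    [S2] are the symmetric and skew parts of [G].  Conversely, (iii) follows from
    the invertibility of [S1], and (i) from the same orthogonality. *)
Require Import Defs.
From mathcomp Require Import all_boot all_order all_algebra.
From mathcomp Require Import reals ring lra.

Set Implicit Arguments.
Unset Strict Implicit.
Unset Printing Implicit Defensive.

Import Order.TTheory GRing.Theory Num.Theory.
Local Open Scope ring_scope.

(** * Quadratic forms and splittings along two kernels *)

Section Forms.
Variable R : realType.

Lemma dotmx_ge0 n (x : 'cV[R]_n) : 0 <= (x^T *m x) 0 0.
Proof. by rewrite mxE sumr_ge0 // => i _; rewrite mxE -expr2 sqr_ge0. Qed.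

Lemma dotmx_eq0 n (x : 'cV[R]_n) : (x^T *m x) 0 0 = 0 -> x = 0.
Proof.
rewrite mxE => x0; apply/matrixP=> i j; rewrite ord1 [RHS]mxE.
have sq k : true -> 0 <= x^T 0 k * x k 0 by rewrite mxE -expr2 sqr_ge0.
by have /eqP := psumr_eq0P sq x0 isT (i := i); rewrite mxE mulf_eq0 orbb => /eqP.
Qed.

Lemma trmx11E (X : 'M[R]_1) : X^T 0 0 = X 0 0.
Proof. by rewrite mxE. Qed.

Lemma form_sym n (M : 'M[R]_n) (x y : 'cV[R]_n) :
  M^T = M -> (x^T *m M *m y) 0 0 = (y^T *m M *m x) 0 0.
Proof. by move=> hM; rewrite -[RHS]trmx11E !trmx_mul trmxK hM mulmxA. Qed.

Lemma formD n (M : 'M[R]_n) (x y : 'cV[R]_n) : M^T = M ->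
  ((x + y)^T *m M *m (x + y)) 0 0 =
  (x^T *m M *m x) 0 0 + 2 * (x^T *m M *m y) 0 0 + (y^T *m M *m y) 0 0.
Proof.
move=> hM; rewrite [(x + y)^T]linearD /= !mulmxDl !mulmxDr.
do 3 rewrite [(_ + _ : 'M_(1, 1)) _ _]mxE; rewrite (form_sym y x hM); ring.
Qed.

(* [t -> form (x - t M x)] is nonnegative and vanishes at [0], where its slope is
   [- 2 |M x|^2]. *)
Lemma nonnegmx_isotropic n (M : 'M[R]_n) (x : 'cV[R]_n) :
  M^T = M -> nonnegmx M -> (x^T *m M *m x) 0 0 = 0 -> M *m x = 0.
Proof.
move=> hM M0 x0; apply: dotmx_eq0; set y := M *m x.
have xMy : (x^T *m M *m y) 0 0 = (y^T *m y) 0 0.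
  by rewrite {2}/y trmx_mul hM.
(* Along [x - t *: y] the form is [- 2 t d + t^2 q], with [d], [q] as named below. The minimiser
   [d / q] may have a zero denominator; [d / (1 + q)] does not and still gives a negative multiple
   of [d ^+ 2]. *)
have := M0 (x + (- ((y^T *m y) 0 0 / (1 + (y^T *m M *m y) 0 0))) *: y).
rewrite formD // x0 [(_ *: y)^T]linearZ /= -!scalemxAr -!scalemxAl.
do 3 rewrite [(_ *: _ : 'M_(1, 1)) _ _]mxE; rewrite xMy.
have := dotmx_ge0 y; have := M0 y.
set q := (y^T *m M *m y) 0 0; set d := (y^T *m y) 0 0 => q0 d0.
have q1 : 1 + q != 0 by rewrite gt_eqF // ltr_wpDr.
have -> : 0 + 2 * (- (d / (1 + q)) * d) + - (d / (1 + q)) * (- (d / (1 + q)) * q)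
  = - (d ^+ 2 * ((2 + q) / (1 + q) ^+ 2)) by field.
rewrite oppr_ge0 pmulr_lle0; last by rewrite divr_gt0 ?exprn_gt0 //; lra.
by move=> h; apply/eqP; rewrite -sqrf_eq0 eq_le h sqr_ge0.
Qed.

Lemma unitmx_inj n (G : 'M[R]_n) :
  (forall v : 'cV[R]_n, G *m v = 0 -> v = 0) -> G \in unitmx.
Proof.
move=> Ginj; rewrite -unitmx_tr -row_free_unit; apply: inj_row_free => v vG.
by apply: trmx_inj; rewrite trmx0; apply: Ginj; rewrite -[G]trmxK -trmx_mul vG trmx0.
Qed.

Lemma posdefmx_unit n (G : 'M[R]_n) : posdefmx G -> G \in unitmx.
Proof.
move=> Gpos; apply: unitmx_inj => v Gv; apply/eqP; apply: contraT => /Gpos.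
by rewrite -mulmxA Gv mulmx0 mxE ltxx.
Qed.

Lemma addv_Ker_fullP n (P Q : 'M[R]_n) :
  (Ker P + Ker Q)%VS = fullv <->
  forall x : 'cV[R]_n, exists x1 x2, [/\ x = x1 + x2, P *m x1 = 0 & Q *m x2 = 0].
Proof.
split=> [PQ x|PQ].
  have : x \in (Ker P + Ker Q)%VS by rewrite PQ memvf.
  case/memv_addP=> x1; rewrite mem_Ker => /eqP P1 [x2].
  by rewrite mem_Ker => /eqP Q2 ->; exists x1, x2.
apply/eqP; rewrite eqEsubv subvf; apply/subvP => x _.
have [x1 [x2 [-> P1 Q2]]] := PQ x.
by apply: memv_add; rewrite mem_Ker ?P1 ?Q2.
Qed.

(** Splitting the columns of the identity makes the decomposition linear in the vector: [x] is
    [X1 *m x + X2 *m x]. *)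
Lemma addv_Ker_full_mx n (P Q : 'M[R]_n) : (Ker P + Ker Q)%VS = fullv ->
  exists X1 X2 : 'M[R]_n, [/\ X1 + X2 = 1%:M, P *m X1 = 0 & Q *m X2 = 0].
Proof.
move/addv_Ker_fullP => PQ.
have /fin_all_exists[f /fin_all_exists[g fg]] i := PQ (col i 1%:M).
exists (\matrix_(i, j) f j i 0), (\matrix_(i, j) g j i 0).
split; apply/matrixP=> i j; have [/matrixP e Pf Qg] := fg j.
- by have := e i 0; rewrite !mxE => <-.
- have /matrixP/(_ i 0) := Pf; rewrite !mxE => {2}<-.
  by apply: eq_bigr => k _; rewrite mxE.
- have /matrixP/(_ i 0) := Qg; rewrite !mxE => {2}<-.
  by apply: eq_bigr => k _; rewrite mxE.
Qed.

End Forms.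

(** * Off-diagonal block matrices with a surjective block *)

Section BlockKernels.
Variables (R : realType) (m n : nat) (B : 'M[R]_(m, n)).
Hypothesis Bfree : row_free B.

Let A : 'M[R]_(m + n) := block_mx 0 B B^T 0.

Let A_sym : A^T = A.
Proof. by rewrite /A tr_block_mx !trmx0 trmxK. Qed.

Let mulA p (v : 'M[R]_(m, p)) (t : 'M[R]_(n, p)) :
  A *m col_mx v t = col_mx (B *m t) (B^T *m v).
Proof. by rewrite mul_block_col !mul0mx add0r addr0. Qed.

Let BtI (v : 'cV[R]_m) : B^T *m v = 0 -> v = 0.
Proof.
have [C BC] := row_freeP Bfree => Bv.
by rewrite -[v]mul1mx -trmx1 -BC trmx_mul -mulmxA Bv mulmx0.
Qed.

Let mulA_eq0 (v : 'cV[R]_m) (t : 'cV[R]_n) :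
  A *m col_mx v t = 0 -> v = 0 /\ B *m t = 0.
Proof. by rewrite mulA => /eqP; rewrite col_mx_eq0 => /andP[/eqP-> /eqP/BtI]. Qed.

Let formA (v : 'cV[R]_m) (t : 'cV[R]_n) :
  ((col_mx v t)^T *m A *m col_mx v t) 0 0 = 2 * (v^T *m (B *m t)) 0 0.
Proof.
rewrite -mulmxA mulA tr_col_mx mul_row_col mxE.
rewrite [X in _ + X](_ : _ = (v^T *m (B *m t)) 0 0); first by ring.
by rewrite -[RHS]trmx11E !trmx_mul trmxK -mulmxA.
Qed.

(** The form of [A] vanishes at [(0, t)], so pairing the equation with this vector makes it
    isotropic for [N]; hence [N], and then [A], kills it. The general [N] covers both [M] and
    [- M]. *)
Let Ker_graph0 (N : 'M[R]_(m + n)) (t : 'cV[R]_n) :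
  (forall x : 'cV[R]_(m + n), (x^T *m N *m x) 0 0 = 0 -> N *m x = 0) ->
  (A + N) *m col_mx 0 t = 0 -> B *m t = 0.
Proof.
move=> N0; rewrite mulmxDl => /eqP; rewrite addr_eq0 => /eqP AN.
have Nx : N *m col_mx 0 t = 0.
  apply: N0; rewrite -mulmxA -[_ *m col_mx _ _]opprK -AN mulmxN mulmxA mxE.
  by rewrite formA trmx0 mul0mx mxE mulr0 oppr0.
by have /mulA_eq0[] : A *m col_mx 0 t = 0 by rewrite AN Nx oppr0.
Qed.

(** Subtracting the kernel vector [(v, T v)] reduces to a vanishing first component. *)
Let Ker_graph (N : 'M[R]_(m + n)) (T : 'M[R]_(n, m)) :
  (forall x : 'cV[R]_(m + n), (x^T *m N *m x) 0 0 = 0 -> N *m x = 0) ->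
  (forall x : 'cV[R]_(m + n), A *m x = 0 -> N *m x = 0) ->
  (A + N) *m col_mx 1%:M T = 0 ->
  forall (v : 'cV[R]_m) (t : 'cV[R]_n),
    (A + N) *m col_mx v t = 0 <-> B *m t = B *m T *m v.
Proof.
move=> N0 KerN NT v t.
have -> : (A + N) *m col_mx v t = (A + N) *m col_mx 0 (t - T *m v).
  rewrite -[LHS]subr0 -[X in _ - X](mul0mx _ v) -NT -mulmxA -mulmxBr.
  by rewrite mul_col_mx mul1mx opp_col_mx add_col_mx subrr.
have -> : B *m t = B *m T *m v <-> B *m (t - T *m v) = 0.
  rewrite mulmxBr mulmxA; split=> [->|/eqP]; first by rewrite subrr.
  by rewrite subr_eq0 => /eqP.
move: (t - _) => {}t; split=> [|Bt]; first exact: Ker_graph0.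
have At : A *m col_mx 0 t = 0 by rewrite mulA Bt mulmx0 col_mx0.
by rewrite mulmxDl At KerN ?addr0.
Qed.

Variable M : 'M[R]_(m + n).
Hypothesis M_sym : M^T = M.

(** [A] acts as [- M] on [X] and as [M] on [Y]; moving it from one side to the other shows that the
    product equals its own opposite. *)
Let cross p q (X : 'M[R]_(m + n, p)) (Y : 'M[R]_(m + n, q)) :
  (A + M) *m X = 0 -> (A - M) *m Y = 0 -> X^T *m A *m Y = 0.
Proof.
rewrite mulmxDl mulmxBl => /eqP; rewrite addr_eq0 => /eqP AX /eqP.
rewrite subr_eq0 => /eqP AY; apply/eqP.
have : X^T *m A *m Y == - (X^T *m A *m Y).
  rewrite -{1}A_sym -trmx_mul AX [(- _)^T]linearN /= trmx_mul /= M_sym mulNmx.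
  by rewrite -!mulmxA AY.
by rewrite -addr_eq0 -mulr2n -scaler_nat scaler_eq0 pnatr_eq0.
Qed.

(** Elasticity enters the theorem only through [B *m t], with [t] the scaled stress; the rest is
    linear algebra for a surjective [B]. *)
Lemma block_kernel_decompositionP :
  [/\ nonnegmx M, (Ker A <= Ker M)%VS & (Ker (A - M) + Ker (A + M))%VS = fullv]
  <->
  exists S1 S2 : 'M[R]_m,
    [/\ S1^T = S1 /\ posdefmx S1,
        S2^T = - S2,
        S1 + S2 \in unitmx /\ S1 - S2 \in unitmx &
        forall (v : 'cV[R]_m) (t : 'cV[R]_n),
          ((A + M) *m col_mx v t = 0 <-> (S1 + S2) *m v + B *m t = 0) /\
          ((A - M) *m col_mx v t = 0 <-> (S1 - S2) *m v - B *m t = 0)].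
Proof.
have [C BC] := row_freeP Bfree.
split=> [[M0 /subvP KerAM full]|[S1 [S2 [[S1t S1pos] S2t _ KerP]]]]; last first.
  have S1u := posdefmx_unit S1pos.
  have pos (v : 'cV[R]_m) : 0 <= (v^T *m S1 *m v) 0 0.
    have [->|/S1pos/ltW//] := eqVneq v 0; by rewrite mulmx0 mxE.
  have S2v (v : 'cV[R]_m) : (v^T *m S2 *m v) 0 0 = 0.
    have := trmx11E (v^T *m S2 *m v).
    by rewrite !trmx_mul trmxK S2t mulNmx mulmxN mulmxA mxE; lra.
  have dec (x : 'cV[R]_(m + n)) : exists x1 x2,
      [/\ x = x1 + x2, (A - M) *m x1 = 0 & (A + M) *m x2 = 0].
    rewrite -[x]vsubmxK; move: (usubmx x) (dsubmx x) => v t.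
    (* Adding the two kernel equations, for [(v - v2, t - t2)] and for [(v2, t2)], eliminates [t2]
       and leaves [2 S1 v2 = (S1 - S2) v - B t]. *)
    pose v2 := invmx (2 *: S1) *m ((S1 - S2) *m v - B *m t).
    pose t2 := - (C *m ((S1 + S2) *m v2)).
    have Bt2 : B *m t2 = - ((S1 + S2) *m v2) by rewrite mulmxN mulmxA BC mul1mx.
    exists (col_mx (v - v2) (t - t2)), (col_mx v2 t2).
    split; first by rewrite add_col_mx !subrK.
      apply/(proj2 (KerP _ _)); rewrite !mulmxBr Bt2.
      have : 2 *: S1 *m v2 = (S1 - S2) *m v - B *m t.
        by rewrite mulKVmx // unitmxZ // unitfE pnatr_eq0.
      rewrite -scalemxAl !mulmxBl !mulmxDl.
      move: (S1 *m v) (S2 *m v) (S1 *m v2) (S2 *m v2) (B *m t) => a b c d e /matrixP E.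
      by apply/matrixP=> i j; have := E i j; rewrite !mxE; lra.
    by apply/(proj1 (KerP _ _)); rewrite Bt2 subrr.
  split.
  (* [M] is [A] on [x1] and [- A] on [x2], and the mixed term vanishes by [cross]. With [v], [v']
     the first components, the form is [2 v . S1 v + 2 v' . S1 v'], the skew part contributing
     nothing. *)
  - move=> x; have [x1 [x2 [-> Mx1 Mx2]]] := dec x; rewrite formD //.
    have /eqP := Mx1; rewrite mulmxBl subr_eq0 => /eqP AMx1.
    have /eqP := Mx2; rewrite mulmxDl addrC addr_eq0 => /eqP MAx2.
    rewrite (form_sym x1 x2 M_sym) -!mulmxA -AMx1 MAx2 !mulmxA.
    rewrite (cross Mx2 Mx1) mulmxN mulmxA.
    move: Mx1 Mx2; rewrite -[x1]vsubmxK -[x2]vsubmxK.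
    move: (usubmx x1) (dsubmx x1) (usubmx x2) (dsubmx x2) => v t v' t'.
    move=> /(proj2 (KerP _ _))/eqP; rewrite subr_eq0 => /eqP Bt.
    move=> /(proj1 (KerP _ _))/eqP; rewrite addrC addr_eq0 => /eqP Bt'.
    rewrite [(- _ : 'M_(1, 1)) _ _]mxE !formA -Bt Bt'.
    rewrite mulmxN !mulmxDl mulNmx !mulmxDr mulmxN !mulmxA.
    have := pos v; have := pos v'; have := S2v v; have := S2v v'.
    do ![rewrite [(- _ : 'M_(1, 1)) _ _]mxE|rewrite [(_ + _ : 'M_(1, 1)) _ _]mxE].
    by rewrite [(0 : 'M_(1, 1)) _ _]mxE; lra.
  - apply/subvP=> x; rewrite !mem_Ker -[x]vsubmxK => /eqP Ax.
    have [v0 Bt] := mulA_eq0 Ax.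
    have /(proj1 (KerP _ _)) : (S1 + S2) *m usubmx x + B *m dsubmx x = 0.
      by rewrite v0 Bt mulmx0 addr0.
    by rewrite mulmxDl Ax add0r => ->.
  - by apply/addv_Ker_fullP.
have KerM (x : 'cV[R]_(m + n)) : A *m x = 0 -> M *m x = 0.
  by move=> Ax; apply/eqP; rewrite -mem_Ker KerAM // mem_Ker Ax.
have KerNM (x : 'cV[R]_(m + n)) : A *m x = 0 -> - M *m x = 0.
  by move=> Ax; rewrite mulNmx KerM // oppr0.
have isoM x := nonnegmx_isotropic (x := x) M_sym M0.
have isoNM (x : 'cV[R]_(m + n)) : (x^T *m - M *m x) 0 0 = 0 -> - M *m x = 0.
  rewrite mulmxN mulNmx mxE => /eqP; rewrite oppr_eq0 => /eqP/isoM.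
  by rewrite mulNmx => ->; rewrite oppr0.
have [X1 [X2 [X12 KX1 KX2]]] := addv_Ker_full_mx full.
(* [L] sends [w] to the first component of the [Ker (A + M)] part of [(0, C w)]; the other part has
   first component [- L w]. *)
pose E : 'M[R]_(m + n, m) := col_mx 0 C; pose L := usubmx (X2 *m E).
have X1E : X1 *m E = E - X2 *m E by rewrite -[X in X - _]mul1mx -X12 mulmxDl addrK.
have uX1E : usubmx (X1 *m E) = - L by rewrite X1E linearB /= col_mxKu sub0r.
(* If [L w = 0], [Ker_graph0] applies to both parts of [(0, C w)], so [w = B C w = 0]. *)
have Lu : L \in unitmx.
  apply: unitmx_inj => w Lw.
  have B2 : B *m (dsubmx (X2 *m E) *m w) = 0.
    apply: (Ker_graph0 isoM); rewrite -Lw -mul_col_mx vsubmxK !mulmxA KX2.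
    by rewrite !mul0mx.
  have B1 : B *m (dsubmx (X1 *m E) *m w) = 0.
    apply: (Ker_graph0 isoNM); rewrite -oppr0 -Lw -mulNmx -uX1E -mul_col_mx.
    by rewrite vsubmxK !mulmxA KX1 !mul0mx.
  rewrite -[w]mul1mx -BC -[C](col_mxKd (0 : 'M_m)) -/E -[E]mul1mx -X12 mulmxDl.
  by rewrite linearD /= -mulmxA mulmxDl mulmxDr B1 B2 addr0.
(* Dividing by [L] and by [- L] turns the first components into the identity. *)
pose T2 := dsubmx (X2 *m E) *m invmx L; pose T1 := - (dsubmx (X1 *m E) *m invmx L).
have Y2 : (A + M) *m col_mx 1%:M T2 = 0.
  by rewrite -(mulmxV Lu) /T2 -mul_col_mx vsubmxK !mulmxA KX2 !mul0mx.
have Y1 : (A - M) *m col_mx 1%:M T1 = 0.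
  have -> : col_mx 1%:M T1 = - (X1 *m E *m invmx L).
    by rewrite -[X1 *m E]vsubmxK mul_col_mx uX1E mulNmx mulmxV // opp_col_mx opprK.
  by rewrite mulmxN !mulmxA KX1 !mul0mx oppr0.
pose G := - (B *m T2).
(* Here [cross] reads [B T1 + (B T2)^T = 0]. *)
have BT1 : B *m T1 = G^T.
  have := cross Y2 Y1; rewrite -mulmxA mulA mulmx1 tr_col_mx mul_row_col trmx1.
  by rewrite mul1mx -trmx_mul => /eqP; rewrite addr_eq0 -linearN => /eqP.
have Gpos : posdefmx G.
  move=> v v0; pose x := col_mx v (T2 *m v).
  have /eqP : (A + M) *m x = 0.
    by rewrite /x -[v in col_mx v _]mul1mx -mul_col_mx mulmxA Y2 mul0mx.
  rewrite mulmxDl addr_eq0 => /eqP Ax.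
  have xMx : (x^T *m M *m x) 0 0 = 2 * (v^T *m G *m v) 0 0.
    rewrite -mulmxA -[M *m x]opprK -Ax mulmxN mulmxA mxE formA mulmxN mulNmx.
    by rewrite [in RHS]mxE -!mulmxA mulrN.
  have vGv : 0 <= (v^T *m G *m v) 0 0 by have := M0 x; rewrite xMx; lra.
  rewrite lt_neqAle vGv andbT eq_sym; apply: contraNN v0 => /eqP vGv0.
  have Mx : M *m x = 0 by apply: isoM; rewrite xMx vGv0 mulr0.
  by have /mulA_eq0[->] : A *m x = 0 by rewrite Ax Mx oppr0.
pose S1 := 2^-1 *: (G + G^T); pose S2 := 2^-1 *: (G - G^T).
have SD : S1 + S2 = G by apply/matrixP=> i j; rewrite !mxE; lra.
have SB : S1 - S2 = G^T by apply/matrixP=> i j; rewrite !mxE; lra.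
have S2t : S2^T = - S2 by apply/matrixP=> i j; rewrite !mxE; lra.
exists S1, S2; rewrite SD SB unitmx_tr posdefmx_unit //; split=> //.
  split; first by apply/matrixP=> i j; rewrite !mxE; lra.
  move=> v v0.
  rewrite -scalemxAr -scalemxAl mulmxDr mulmxDl mxE.
  rewrite [(_ + _ : 'M_(1, 1)) _ _]mxE -[X in _ + X]trmx11E !trmx_mul !trmxK mulmxA.
  have := Gpos v v0; lra.
move=> v t; split.
  rewrite (Ker_graph isoM KerM Y2) mulNmx addrC; split=> [->|/eqP].
    by rewrite subrr.
  by rewrite subr_eq0 => /eqP.
rewrite (Ker_graph isoNM KerNM Y1) BT1; split=> [->|/eqP]; first by rewrite subrr.
by rewrite subr_eq0 => /eqP.
Qed.

End BlockKernels.

(** * The elasticity matrices and the traction [sigma nu] *)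

Section Elasticity.
Variable R : realType.

Lemma sum_ord3 (V : nmodType) (F : 'I_3 -> V) : \sum_(i < 3) F i = F 0 + F 1 + F 2.
Proof.
by rewrite !big_ord_recr big_ord0 /= add0r;
  congr (F _ + F _ + F _); apply: val_inj.
Qed.

Lemma ord3P (P : 'I_3 -> Prop) : P 0 -> P 1 -> P 2 -> forall i, P i.
Proof.
move=> P0 P1 P2 [[|[|[|//]]] lti].
- by rewrite (_ : Ordinal lti = 0) //; apply: val_inj.
- by rewrite (_ : Ordinal lti = 1) //; apply: val_inj.
- by rewrite (_ : Ordinal lti = 2) //; apply: val_inj.
Qed.

Lemma sigma_prE (sigma : 'M[R]_3) :
  sigma_pr sigma = col_mx
    (mx_of_rows 3 1 [:: [:: sigma 0 0]; [:: sigma 1 1]; [:: sigma 2 2]])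
    (mx_of_rows 3 1 [:: [:: sigma 0 1]; [:: sigma 0 2]; [:: sigma 1 2]]).
Proof.
apply/matrixP=> i j; rewrite ord1 [RHS]mxE mxE.
by case: splitP => k ->; rewrite mxE; elim/ord3P: k.
Qed.

Lemma sigma_pr_surj (s : 'cV[R]_(3 + 3)) :
  exists2 sigma, sigma^T = sigma & sigma_pr sigma = s.
Proof.
rewrite -[s]vsubmxK; move: (usubmx s) (dsubmx s) => d o.
exists (mx_of_rows 3 3 [:: [:: d 0 0; o 0 0; o 1 0];
                           [:: o 0 0; d 1 0; o 2 0];
                           [:: o 1 0; o 2 0; d 2 0]]).
  by apply/matrixP=> i j; rewrite !mxE; elim/ord3P: i; elim/ord3P: j.
rewrite sigma_prE; congr col_mx; apply/matrixP=> i j;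
  by rewrite ord1 !mxE; elim/ord3P: i.
Qed.

Variables (lambda mu : R) (nu : 'cV[R]_3).
Hypotheses (hmu : 0 < mu) (hlambda : 0 < 2 * mu + 3 * lambda).

Let D : 'M[R]_(3 + 3) :=
  block_mx (invmx (Ctilde_sqrt lambda mu)) 0 0 (Num.sqrt mu)^-1%:M.
Let B : 'M[R]_(3, 3 + 3) := row_mx (A'_ lambda mu nu) (A''_ mu nu).

Let C_unit : Ctilde_sqrt lambda mu \in unitmx.
Proof. by have [_ /posdefmx_unit] := Ctilde_sqrtP hmu hlambda. Qed.

Let sqrt_mu0 : Num.sqrt mu != 0.
Proof. by rewrite gt_eqF ?sqrtr_gt0. Qed.

Lemma A0tilde_sqrt_col (v : 'cV[R]_3) (s : 'cV[R]_(3 + 3)) :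
  A0tilde_sqrt lambda mu *m col_mx v s = col_mx v (D *m s).
Proof. by rewrite mul_block_col !mul0mx mul1mx addr0 add0r. Qed.

Lemma A_block : A_ lambda mu nu = block_mx 0 B B^T 0.
Proof. by rewrite /A_ tr_row_mx. Qed.

(** Lets symmetric stresses stand for arbitrary vectors [t] in the abstract equivalence. *)
Lemma stress_surj (t : 'cV[R]_(3 + 3)) :
  exists2 sigma, sigma^T = sigma & D *m sigma_pr sigma = t.
Proof.
pose C := block_mx (Ctilde_sqrt lambda mu) 0 0 (Num.sqrt mu)%:M : 'M[R]_(3 + 3).
have DC : D *m C = 1%:M.
  rewrite mulmx_block !mulmx0 !mul0mx !addr0 !add0r mulVmx // -scalar_mxM.
  by rewrite mulVf // -scalar_mx_block.
have [sigma sym_sigma E] := sigma_pr_surj (C *m t).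
by exists sigma; rewrite // E mulmxA DC mul1mx.
Qed.

(** [A'_] is minus [diag nu] times [Ctilde_sqrt], and [A''_] carries the factor [- sqrt mu]; the
    scaling [D] cancels both square roots. *)
Lemma traction (sigma : 'M[R]_3) : sigma^T = sigma ->
  B *m (D *m sigma_pr sigma) = - (sigma *m nu).
Proof.
move=> sym_sigma.
have sE i j : sigma i j = sigma j i by rewrite -{1}sym_sigma mxE.
have A'E : A'_ lambda mu nu = - (diag_mx nu^T *m Ctilde_sqrt lambda mu).
  by congr -%R; apply/matrixP=> i j; rewrite mul_diag_mx !mxE;
    elim/ord3P: i; elim/ord3P: j.
rewrite mulmxA mul_row_block !mulmx0 addr0 add0r A'E mulNmx mulmxK //.
rewrite mul_mx_scalar scalerA mulrN mulVf // scaleN1r sigma_prE mul_row_col.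
apply/matrixP=> i j; rewrite ord1 mulNmx mul_diag_mx !mxE !sum_ord3 !mxE.
by elim/ord3P: i; rewrite /= ?(sE 1 0) ?(sE 2 0) ?(sE 2 1); ring.
Qed.

(** For a unit [nu] every vector is the traction of a symmetric stress, so a [v] with [v B = 0] is
    orthogonal to itself. *)
Lemma row_free_traction : \sum_(i < 3) nu i 0 ^+ 2 = 1 -> row_free B.
Proof.
move=> hnu; apply: inj_row_free => v vB; apply: trmx_inj; rewrite trmx0.
have nu1 : nu^T *m nu = 1%:M.
  rewrite [LHS]mx11_scalar mxE -hnu; congr _%:M.
  by apply: eq_bigr => i _; rewrite mxE expr2.
pose c := (v *m nu) 0 0.
(* The first two terms send [nu] to [v^T + c nu]; the last one removes [c nu]. *)
pose sigma := v^T *m nu^T + nu *m v - c *: (nu *m nu^T).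
have sym_sigma : sigma^T = sigma.
  rewrite /sigma !(linearD, linearN, linearZ) /= !trmx_mul !trmxK.
  by rewrite [nu *m v + _]addrC.
have sigma_nu : sigma *m nu = v^T.
  rewrite mulmxBl mulmxDl -scalemxAl -!mulmxA nu1 !mulmx1 [v *m nu]mx11_scalar.
  by rewrite mul_mx_scalar addrK.
apply: dotmx_eq0; rewrite trmxK -[X in _ *m X]sigma_nu -[sigma *m nu]opprK -traction //.
by rewrite mulmxN !mulmxA vB !mul0mx oppr0 mxE.
Qed.

End Elasticity.

Theorem proposition3p11 (R : realType) (lambda mu : R)
    (hmu : 0 < mu) (hlambda : 0 < 2 * mu + 3 * lambda)
    (nu : 'cV[R]_3) (hnu : \sum_(i < 3) nu i 0 ^+ 2 = 1)
    (M : 'M[R]_(3 + (3 + 3))) (hM : M^T = M) :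
  let A := A_ lambda mu nu in
  [/\ nonnegmx M,
      (Ker A <= Ker M)%VS &
      (Ker (A - M) + Ker (A + M))%VS = fullv]
  <->
  exists S1 S2 : 'M[R]_3,
    [/\ S1^T = S1 /\ posdefmx S1,
        S2^T = - S2,
        S1 + S2 \in unitmx /\ S1 - S2 \in unitmx &
        forall (v : 'cV[R]_3) (sigma : 'M[R]_3), sigma^T = sigma ->
          let U := A0tilde_sqrt lambda mu *m col_mx v (sigma_pr sigma) in
          ((A + M) *m U = 0 <-> (S1 + S2) *m v - sigma *m nu = 0) /\
          ((A - M) *m U = 0 <-> (S1 - S2) *m v + sigma *m nu = 0)].
Proof.
move=> A; rewrite /A A_block.
rewrite (block_kernel_decompositionP (row_free_traction hmu hlambda hnu) hM).
split=> -[S1 [S2 [S1P S2P SP KerP]]]; exists S1, S2; split=> //.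
  move=> v sigma sym_sigma; rewrite A0tilde_sqrt_col.
  rewrite -[sigma *m nu]opprK -(traction nu hmu hlambda sym_sigma) opprK.
  exact: KerP.
move=> v t; have [sigma sym_sigma <-] := stress_surj hmu hlambda t.
rewrite (traction nu hmu hlambda sym_sigma) -A0tilde_sqrt_col opprK.
exact: KerP.
Qed.
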